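(* Let $\Omega$ be a bounded convex domain of $\mathbb{R}^n$ with its Funk metric $F_\Omega$. The following are equivalent: (1) $\Omega$ is strictly convex. (2) $\Omega$ is uniquely geodesic for the Funk metric. (3) A subset $A\subset\Omega$ is geodesically convex for the Funk metric if and only if $A$ is affinely convex. (4) The forward open balls in $\Omega$ are geodesically convex with respect to $F_\Omega$.
   Context: A convex domain is a non-empty open convex subset of $\mathbb{R}^n$. For bounded $\Omega$ and $x\neq y$ in $\Omega$, $a_\Omega(x,y)$ is the unique intersection point of the ray $\{x+t(y-x):t\ge0\}$ with $\partial\Omega$; the Funk metric is $F_\Omega(x,x)=0$ and $F_\Omega(x,y)=\log\frac{|x-a|}{|y-a|}$, $a=a_\Omega(x,y)$, for $x\ne y$. Forward open balls are $B^+(x,\rho)=\{y\in\Omega:F_\Omega(x,y)<\rho\}$, $x\in\Omega$, $\rho>0$. $\Omega$ is strictly convex if $\partial\Omega$ contains no non-trivial segment. A path is a continuous map $\gamma:[a,b]\to\Omega$; its length is $\sup\sum_i F_\Omega(\gamma(t_i),\gamma(t_{i+1}))$ over all subdivisions $a=t_0<\dots<t_N=b$; $\gamma$ is a geodesic if $F_\Omega(\gamma(a),\gamma(b))=\mathrm{Length}(\gamma)$. $\Omega$ is uniquely geodesic if for every ordered pair of points there is a geodesic path joining the first to the second and it is unique up to reparametrization. A subset $A\subset\Omega$ is geodesically convex if, given any two points of $A$, every geodesic path joining them is contained in $A$; it is affinely convex if it contains the Euclidean segment joining any two of its points. Statement (3) is meant for all subsets $A\subset\Omega$, and (4) for all forward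 open balls. *)

(* Defs.v *)
(* MathComp-Analysis: R is any realType, R^n is 'rV[R]_n. *)
From HB Require Import structures.
From mathcomp Require Import all_boot all_order all_algebra.
From mathcomp Require Import interval_inference.
From mathcomp Require Import all_classical.
From mathcomp Require Import reals ereal topology normedtype convex exp numfun.

Set Implicit Arguments.
Unset Strict Implicit.
Unset Printing Implicit Defensive.

Import Order.TTheory GRing.Theory Num.Theory.
Import numFieldNormedType.Exports.

Local Open Scope classical_set_scope.
Local Open Scope ring_scope.

Section FunkGeometry.
Context {R : realType} {n : nat}.
Local Notation V := 'rV[R]_n.
Implicit Types (Omega A : set V) (x y : V) (a b c d : R) (gamma delta : R -> V).

(* The library norm `|x| of 'rV[R]_n is the sup norm; it has the same topology
   and the same bounded sets, but Euclidean distances need this one. *)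
Definition enorm (v : V) : R := Num.sqrt (\sum_(j < n) v ord0 j ^+ 2).

Definition boundary A : set V := closure A `\` A°.

Definition segment x y : set V :=
  [set (1 - t) *: x + t *: y | t in `[0, 1]].

Definition ray x y : set V :=
  [set x + t *: (y - x) | t in `[0, +oo[].

Definition convex_domain Omega : Prop :=
  [/\ Omega !=set0, open Omega & convex_set Omega].

Definition strictly_convex Omega : Prop :=
  ~ exists x y, x != y /\ segment x y `<=` boundary Omega.

(* For Omega a bounded convex domain and x != y in Omega, the set below is a
   singleton; the value 0 is used when it is empty. *)
Definition exit_point Omega x y : V :=
  xget 0 (ray x y `&` boundary Omega).

Definition funk Omega x y : R :=
  if x == y then 0
  else let p := exit_point Omega x y in ln (enorm (x - p) / enorm (y - p)).

Definition forward_ball Omega x (rho : R) : set V :=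
  [set y | Omega y /\ funk Omega x y < rho].

(* A path [a, b] -> Omega is a total function R -> V of which only the
   restriction to [a, b] matters. *)
Definition is_path Omega a b gamma : Prop :=
  [/\ a < b, {within `[a, b], continuous gamma}
    & gamma @` `[a, b] `<=` Omega].

(* itv_partition a b s says that a :: s is strictly increasing from a to b. *)
Definition path_length Omega a b gamma : \bar R :=
  ereal_sup [set (\sum_(0 <= i < size s)
      funk Omega (gamma (nth b (a :: s) i)) (gamma (nth b (a :: s) i.+1)))%:E
    | s in itv_partition a b].

Definition geodesic Omega a b gamma : Prop :=
  is_path Omega a b gamma /\
  (funk Omega (gamma a) (gamma b))%:E = path_length Omega a b gamma.

Definition geodesic_joining Omega x y a b gamma : Prop :=
  [/\ geodesic Omega a b gamma, gamma a = x & gamma b = y].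

(* A geodesic may be constant on subintervals, so the change of parameter
   [c, d] -> [a, b] is only required to be monotone, not injective. *)
Definition reparametrization a b gamma c d delta : Prop :=
  exists phi : R -> R,
    [/\ {within `[c, d], continuous phi},
        {in `[c, d] &, {homo phi : s t / s <= t}},
        phi c = a, phi d = b
      & {in `[c, d], forall t, delta t = gamma (phi t)}].

Definition uniquely_geodesic Omega : Prop :=
  forall x y, Omega x -> Omega y ->
    exists a b gamma, geodesic_joining Omega x y a b gamma /\
      forall c d delta, geodesic_joining Omega x y c d delta ->
        reparametrization a b gamma c d delta.

Definition geodesically_convex Omega A : Prop :=
  forall x y, A x -> A y ->
    forall a b gamma, geodesic_joining Omega x y a b gamma ->
      gamma @` `[a, b] `<=` A.

End FunkGeometry.

(* Main.v *)
Require Import Defs.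
From HB Require Import structures.
From mathcomp Require Import all_boot all_order all_algebra.
From mathcomp Require Import interval_inference ring lra.
From mathcomp Require Import all_classical.
From mathcomp Require Import reals ereal topology normedtype convex exp numfun.
From mathcomp Require Import sequences.

Set Implicit Arguments.
Unset Strict Implicit.
Unset Printing Implicit Defensive.

Import Order.TTheory GRing.Theory Num.Theory.
Import numFieldNormedType.Exports.

Local Open Scope classical_set_scope.
Local Open Scope ring_scope.

(** Throughout, O is a bounded convex domain.  For x <> y in O, a boundary point
    a is the exit point of the ray from x through y exactly when
    y = a + k (x - a) for some k in ]0, 1[; then F(x, y) = - ln k
    (funk_contract).  More generally, if
    y = w + k (x - w) with w merely in the closure of O, then
    F(x, y) <= - ln k, with equality only if w lies on the boundary
    (funk_le_closure).

    The triangle inequality and its equality case follow without any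
    supporting hyperplane.  If y = a + k (x - a) and z = b + l (y - b), then
    z = w + k l (x - w) for some w in the open segment ]a, b[ (exit_compose),
    so F(x, z) <= - ln (k l) = F(x, y) + F(y, z), and equality puts w on the
    boundary.  A boundary point inside ]a, b[ forces the whole of [a, b] into
    the boundary (segment_boundary), hence a = b when O is strictly convex, and
    then x, y, z are aligned (strictly_convex_between).  On a segment F is a
    difference G t - G s, so segments are geodesics (segment_geodesic); in the
    strictly convex case every geodesic runs monotonically along the segment
    joining its ends (strictly_convex_uniquely_geodesic).

    If geodesics are unique, the segment and any other geodesic with the same
    ends have the same image, so geodesic and affine convexity coincide
    (uniquely_geodesic_convexity).  A forward ball of centre x is the image of
    O under a homothety of centre x (forward_ball_homothety), hence affinely
    convex.

    Conversely, let the boundary contain a segment [p, q] of midpoint m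
    (flat_face_ball).  F is additive along any path all of whose forward chords
    exit through [p, q].  Let c be in O.  Seen from a point x0 of [c, m] very
    close to m, the directions towards [p, q] fill almost a half-plane.  A
    broken line from c to (c + m) / 2 through a point far away in the direction
    q - p, outside O, uses only such directions.  A homothety of centre x0 and
    small ratio maps it to a geodesic whose ends are in a forward ball of
    centre x0 and whose middle vertex is not. *)

Section FunkTheory.
Context {R : realType} {n : nat}.
Local Notation V := 'rV[R]_n.
Implicit Types (O A : set V) (x y z w a b p q : V).

(** * Open convex sets and their boundary *)

Lemma convex_segment A x y (t : R) :
  convex_set A -> A x -> A y -> 0 <= t <= 1 -> A (x + t *: (y - x)).
Proof.
move=> cA Ax Ay /andP[t0 t1].
have := cA y x (Itv01 t0 t1) (mem_set Ay) (mem_set Ax).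
move/set_mem; congr A.
by rewrite /conv /=; apply/rowP => i; rewrite !mxE /unstable.onem; ring.
Qed.

Lemma segment_convex A :
  (forall x y (t : R), A x -> A y -> 0 <= t <= 1 -> A (x + t *: (y - x))) ->
  convex_set A.
Proof.
move=> cA x y t /set_mem Ax /set_mem Ay; apply/mem_set.
have := cA y x t%:num Ay Ax; rewrite ge0 le1 => /(_ isT); congr A.
by rewrite /conv /=; apply/rowP => i; rewrite !mxE /unstable.onem; ring.
Qed.

Lemma boundaryE O w : open O -> boundary O w = (closure O w /\ ~ O w).
Proof. by move=> /interior_id oO; rewrite /boundary oO. Qed.

Lemma segmentP p q x :
  segment p q x <-> exists2 t : R, 0 <= t <= 1 & x = p + t *: (q - p).
Proof.
split=> [[t t01 <-]|[t t01 ->]]; exists t => //.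
- by apply/rowP => i; rewrite !mxE; ring.
- by apply/rowP => i; rewrite !mxE; ring.
Qed.

Lemma line_continuous x y : continuous (fun t : R => x + t *: y).
Proof.
move=> t; apply: (@cvgD _ _ _ (nbhs t)); first exact: cst_continuous.
by apply: (@cvgZ _ _ _ (nbhs t)); [exact: cvg_id | exact: cst_continuous].
Qed.

Lemma homothety_continuous x (k : R) : continuous (fun v : V => x + k *: v).
Proof.
move=> v; apply: (@cvgD _ _ _ (nbhs v)); first exact: cst_continuous.
by apply: (@cvgZ _ _ _ (nbhs v)); [exact: cst_continuous | exact: cvg_id].
Qed.

(** The segment from a point of an open convex set to a point of its closure,
    the latter excluded, stays in the set. *)
Lemma interior_segment O x w (k : R) : open O -> convex_set O ->
  O x -> closure O w -> 0 < k <= 1 -> O (w + k *: (x - w)).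
Proof.
move=> oO cO Ox clw /andP[k0 k1].
(* f v is the point x' such that w + k (x - w) is on the segment from v to x';
   f w = x, so x' is in O for v close to w. *)
pose p := w + k *: (x - w).
pose f v : V := k^-1 *: p + (- (1 - k) / k) *: v.
have fc : continuous f by exact: homothety_continuous.
have fw : f w = x.
  by apply/rowP => i; rewrite /f /p !mxE; field; rewrite gt_eqF.
have : nbhs w (f @^-1` O).
  by apply: fc; apply: open_nbhs_nbhs; rewrite fw; split.
move=> /clw[v [Ov Ofv]].
have := convex_segment cO Ofv Ov (_ : 0 <= 1 - k <= 1).
rewrite subr_ge0 k1 lerBlDr lerDl (ltW k0) => /(_ isT); congr O.
by apply/rowP => i; rewrite /f /p !mxE; field; rewrite gt_eqF.
Qed.

Lemma closure_convex O x y (t : R) : open O -> convex_set O ->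
  closure O x -> closure O y -> 0 <= t <= 1 -> closure O (x + t *: (y - x)).
Proof.
move=> oO cO clx cly /andP[t0 t1].
pose f v : V := t *: y + (1 - t) *: v.
have fc : continuous f by exact: homothety_continuous.
have -> : x + t *: (y - x) = f x.
  by apply/rowP => i; rewrite /f !mxE; ring.
have [tE|tn1] := eqVneq t 1.
  by rewrite /f tE scale1r subrr scale0r addr0.
rewrite [closure O](iffLR (closure_id _)); last exact: closed_closure.
move=> B /fc /clx[v [Ov Bfv]]; exists (f v); split => //.
apply: subset_closure.
have := interior_segment oO cO Ov cly (_ : 0 < 1 - t <= 1).
rewrite subr_gt0 lt_neqAle tn1 t1 lerBlDr lerDl t0 => /(_ isT); congr O.
by apply/rowP => i; rewrite /f !mxE; ring.
Qed.

(** A segment between boundary points that meets the boundary in its relative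
    interior lies entirely in the boundary. *)
Lemma segment_boundary O a b w (s : R) : open O -> convex_set O ->
  boundary O a -> boundary O b -> 0 < s < 1 -> w = a + s *: (b - a) ->
  boundary O w -> segment a b `<=` boundary O.
Proof.
move=> oO cO; rewrite !boundaryE // => -[cla Oa] [clb Ob] /andP[s0 s1] ws.
move=> [_ Ow].
move=> x /segmentP[t /andP[t0 t1] ->].
rewrite boundaryE //; split; first by apply: closure_convex; rewrite ?t0.
move=> Ox; apply: Ow.
have [st|ts] := leP s t.
  have /andP[k0 k1] : 0 < s / t <= 1.
    have t0' : 0 < t by exact: lt_le_trans st.
    by rewrite divr_gt0 //= ler_pdivrMr // mul1r.
  have := interior_segment oO cO Ox cla (_ : 0 < s / t <= 1).
  rewrite k0 k1 => /(_ isT); congr O; rewrite ws.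
  apply/rowP => i; rewrite !mxE; field.
  by rewrite gt_eqF //; exact: lt_le_trans st.
have t1' : 0 < 1 - t by rewrite subr_gt0 (lt_trans ts).
have := interior_segment oO cO Ox clb (_ : 0 < (1 - s) / (1 - t) <= 1).
rewrite divr_gt0 //= ?subr_gt0 // ler_pdivrMr // mul1r lerD2l lerN2 ltW //.
move=> /(_ isT); congr O; rewrite ws.
by apply/rowP => i; rewrite !mxE; field; rewrite gt_eqF.
Qed.

(** * Exit points and the Funk metric *)

Lemma exit_pointE O x y a (k : R) : open O -> convex_set O ->
  O x -> boundary O a -> 0 < k < 1 -> y = a + k *: (x - a) ->
  exit_point O x y = a.
Proof.
move=> oO cO Ox ba /andP[k0 k1] ->; have k1' : 0 < 1 - k by rewrite subr_gt0.
have rayE t : 0 <= t -> ray x (a + k *: (x - a)) (x + t *: (a - x)).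
  move=> t0; exists (t / (1 - k)).
    by rewrite /= in_itv /= andbT divr_ge0 // ltW.
  by apply/rowP => i; rewrite !mxE; field; rewrite gt_eqF.
apply: xget_unique.
  split=> //; have := rayE 1 ler01; congr (ray _ _ _).
  by apply/rowP => i; rewrite !mxE; ring.
move=> b [[t]]; rewrite /= in_itv /= andbT => t0 <- {rayE}.
move: ba; rewrite !boundaryE // => -[cla Oa] [clb Ob].
have [tk|kt|tk] := ltgtP (t * (1 - k)) 1.
- case: Ob.
  have := interior_segment oO cO Ox cla (_ : 0 < 1 - t * (1 - k) <= 1).
  rewrite subr_gt0 tk lerBlDr lerDl mulr_ge0 // ?(ltW k1') // => /(_ isT).
  congr O; by apply/rowP => i; rewrite !mxE; ring.
- case: Oa.
  have tk0 : 0 < t * (1 - k) by exact: lt_trans kt.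
  have tn0 : t != 0 by apply: contraTneq tk0 => ->; rewrite mul0r ltxx.
  have := interior_segment oO cO Ox clb (_ : 0 < 1 - (t * (1 - k))^-1 <= 1).
  rewrite subr_gt0 invf_lt1 // kt lerBlDr lerDl invr_ge0 (ltW tk0) => /(_ isT).
  congr O; apply/rowP => i; rewrite !mxE; field.
  by rewrite tn0 gt_eqF.
- have -> : t = (1 - k)^-1 by rewrite -[LHS](mulfK (lt0r_neq0 k1')) tk mul1r.
  by apply/rowP => i; rewrite !mxE; field; rewrite gt_eqF.
Qed.

Lemma enormZ (c : R) (v : V) : enorm (c *: v) = `|c| * enorm v.
Proof.
rewrite /enorm -sqrtr_sqr -sqrtrM ?sqr_ge0 // mulr_sumr.
by congr Num.sqrt; apply: eq_bigr => j _; rewrite mxE exprMn.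
Qed.

Lemma enorm_gt0 (v : V) : v != 0 -> 0 < enorm v.
Proof.
move=> v0; rewrite sqrtr_gt0 lt_neqAle sumr_ge0 ?andbT; last first.
  by move=> j _; exact: sqr_ge0.
apply: contra v0; rewrite eq_sym psumr_eq0; last first.
  by move=> j _; exact: sqr_ge0.
move=> /allP v0.
apply/eqP/rowP => j; rewrite mxE.
by have := v0 j (mem_index_enum _); rewrite sqrf_eq0 => /eqP.
Qed.

(** Evaluation of the metric from a known exit point; the case y = x is covered
    by q = p. *)
Lemma funkE O x y a (p q : R) : open O -> convex_set O -> O x ->
  boundary O a -> 0 < q <= p -> p *: (y - a) = q *: (x - a) ->
  funk O x y = ln p - ln q.
Proof.
move=> oO cO Ox ba /andP[q0 qp] E.
have p0 : 0 < p by exact: lt_le_trans qp.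
have yE : y = a + (q / p) *: (x - a).
  apply/rowP => i; have := congr1 (fun v : V => v ord0 i) E.
  rewrite !mxE => Ei; apply: (mulfI (lt0r_neq0 p0)).
  transitivity (p * (y ord0 i - a ord0 i) + p * a ord0 i); first by ring.
  by rewrite Ei; field; rewrite gt_eqF.
have xa : x - a != 0.
  rewrite subr_eq0; apply/eqP => xa; move: ba.
  by rewrite -xa boundaryE // => -[].
rewrite /funk; case: eqVneq => [xy|xy].
  suff -> : p = q by rewrite subrr.
  move: E; rewrite -xy => /eqP; rewrite -subr_eq0 -scalerBl scaler_eq0.
  by rewrite (negbTE xa) orbF subr_eq0 => /eqP.
have qp1 : 0 < q / p < 1.
  rewrite divr_gt0 //= ltr_pdivrMr // mul1r lt_neqAle qp andbT.
  apply: contra_neq xy => qpE; rewrite yE qpE divff ?gt_eqF // scale1r.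
  by rewrite addrC subrK.
rewrite /= (exit_pointE oO cO Ox ba qp1 yE) -ln_div ?posrE //.
have -> : y - a = (q / p) *: (x - a) by rewrite yE addrAC subrr add0r.
rewrite enormZ gtr0_norm ?divr_gt0 //; congr ln.
have := lt0r_neq0 (enorm_gt0 xa) => e0; field.
by rewrite e0 !gt_eqF.
Qed.

(** Lines leave bounded sets. *)
Lemma bounded_line O x v : bounded_set O -> v != 0 ->
  exists B : R, forall t, O (x + t *: v) -> t <= B.
Proof.
move=> [M [_ /(_ (M + 1))]]; rewrite ltrDl ltr01 => /(_ isT) bO v0.
exists ((M + 1 + `|x|) / `|v|) => t Ot.
rewrite ler_pdivlMr ?normr_gt0 //.
apply: (@le_trans _ _ `|t *: v|); first by rewrite normrZ ler_wpM2r // ler_norm.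
have -> : t *: v = (x + t *: v) - x by rewrite addrAC subrr add0r.
by apply: (le_trans (ler_normB _ _)); rewrite lerD2r; exact: bO.
Qed.

(** The exit point is reached at the supremum T of the parameters whose point on
    the ray lies in O. *)
Lemma exit_exists O x y : open O -> bounded_set O -> O x -> O y -> x != y ->
  exists a (k : R), [/\ boundary O a, 0 < k < 1 & y = a + k *: (x - a)].
Proof.
move=> oO bO Ox Oy xy; have v0 : y - x != 0 by rewrite subr_eq0 eq_sym.
pose f (t : R) : V := x + t *: (y - x).
have fc : continuous f by exact: line_continuous.
have [B SB] := bounded_line x bO v0.
have ubS : has_ubound (f @^-1` O) by exists B.
have f1 : f 1 = y by rewrite /f scale1r addrC subrK.
have S1 : (f @^-1` O) 1 by rewrite /= f1.
set T := sup (f @^-1` O).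
have clT : closure O (f T).
  move=> C /fc CT; have [t [Ot Ct]] := closure_sup (ex_intro _ _ S1) ubS CT.
  by exists (f t).
have OT : ~ O (f T).
  move=> OfT; have : nbhs T (f @^-1` O) by apply/fc/open_nbhs_nbhs.
  move=> /nbhs_ballP[e /= e0 /(_ (T + e / 2))].
  rewrite /ball /= opprD addrA subrr add0r normrN gtr0_norm ?divr_gt0 //.
  rewrite ltr_pdivrMr // ltr_pMr // ltr1n => /(_ isT) OTe.
  have TeT : T + e / 2 <= T by exact: (ub_le_sup ubS).
  have : 0 < e / 2 by rewrite divr_gt0.
  by move: TeT; lra.
have T1 : 1 < T.
  rewrite lt_neqAle (ub_le_sup ubS) // andbT.
  by apply/eqP => T1; apply: OT; rewrite -T1 f1.
have T0 : 0 < T by exact: lt_trans T1.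
exists (f T), (1 - T^-1); split; first by rewrite boundaryE.
  by rewrite subr_gt0 invf_lt1 // T1 ltrBlDr ltrDl invr_gt0.
by apply/rowP => i; rewrite /f !mxE; field; rewrite gt_eqF.
Qed.

Lemma funk_contract O x y a (k : R) : open O -> convex_set O ->
  O x -> boundary O a -> 0 < k <= 1 -> y = a + k *: (x - a) ->
  funk O x y = - ln k.
Proof.
move=> oO cO Ox ba k01 ->; rewrite (funkE (p := 1) (q := k) oO cO Ox ba k01).
  by rewrite ln1 add0r.
by apply/rowP => i; rewrite !mxE; ring.
Qed.

Lemma funk_xx O x : funk O x x = 0.
Proof. by rewrite /funk eqxx. Qed.

Lemma funk_gt0 O x y : open O -> convex_set O -> bounded_set O ->
  O x -> O y -> x != y -> 0 < funk O x y.
Proof.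
move=> oO cO bO Ox Oy xy.
have [a [k [ba /andP[k0 k1] yE]]] := exit_exists oO bO Ox Oy xy.
by rewrite (funk_contract oO cO Ox ba _ yE) ?k0 ?ltW // oppr_gt0 ln_lt0 ?k0.
Qed.

Lemma funk_ge0 O x y : open O -> convex_set O -> bounded_set O ->
  O x -> O y -> 0 <= funk O x y.
Proof.
move=> oO cO bO Ox Oy; have [->|xy] := eqVneq x y; first by rewrite funk_xx.
exact/ltW/funk_gt0.
Qed.

(** If w, in the closure of O, lies on the ray from x through y beyond y, the
    exit point of that ray cannot come before w. *)
Lemma funk_le_closure O x y w (k : R) :
  open O -> convex_set O -> bounded_set O ->
  O x -> closure O w -> 0 < k <= 1 -> y = w + k *: (x - w) ->
  funk O x y <= - ln k /\
  (x != y -> funk O x y = - ln k -> boundary O w).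
Proof.
move=> oO cO bO Ox clw k01 yE; have /andP[k0 k1] := k01.
have Oy : O y by rewrite yE; exact: interior_segment.
have [xy|xy] := eqVneq x y; first by rewrite xy funk_xx oppr_ge0 ln_le0.
have [a [l [ba /andP[l0 l1] yEa]]] := exit_exists oO bO Ox Oy xy.
rewrite (funk_contract oO cO Ox ba _ yEa) ?l0 ?(ltW l1) //.
have l1' : 1 - l != 0 by rewrite gt_eqF // subr_gt0.
have aE : a = w + ((k - l) / (1 - l)) *: (x - w).
  apply/rowP => i; have := congr1 (fun v : V => v ord0 i) yE.
  rewrite yEa !mxE => Ei; apply: (mulfI l1').
  transitivity (a ord0 i + l * (x ord0 i - a ord0 i) - l * x ord0 i).
    by ring.
  by rewrite Ei; field.
(* Otherwise a would lie strictly before w on the ray, hence in O. *)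
have kl : k <= l.
  rewrite leNgt; apply/negP => lk.
  move: ba; rewrite boundaryE // => -[_]; apply.
  rewrite aE; apply: interior_segment => //.
  by rewrite divr_gt0 ?subr_gt0 //= ler_pdivrMr ?subr_gt0 // mul1r lerD2r.
rewrite lerN2 ler_ln ?posrE //; split=> // _ /oppr_inj/ln_inj kE.
by move: ba; rewrite aE kE ?posrE // subrr mul0r scale0r addr0.
Qed.

(** * Triangle inequality and its equality case *)

(** Composing the contraction of ratio k towards a with that of ratio l towards
    b gives the contraction of ratio k l towards a point w of the open segment
    ]a, b[. *)
Lemma exit_compose O x y z : open O -> convex_set O -> bounded_set O ->
  O x -> O y -> O z -> x != y -> y != z ->
  exists a b w (k l s : R),
    [/\ boundary O a, boundary O b, 0 < k < 1, 0 < l < 1 & 0 < s < 1] /\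
    [/\ w = a + s *: (b - a), y = a + k *: (x - a), z = b + l *: (y - b),
      z = w + (k * l) *: (x - w)
      & funk O x y + funk O y z = - ln (k * l)].
Proof.
move=> oO cO bO Ox Oy Oz xy yz.
have [a [k [ba /andP[k0 k1] yE]]] := exit_exists oO bO Ox Oy xy.
have [b [l [bb /andP[l0 l1] zE]]] := exit_exists oO bO Oy Oz yz.
have kl1 : 0 < 1 - k * l.
  by rewrite subr_gt0; apply: (lt_trans _ l1); rewrite gtr_pMl.
have n0 : 1 - k * l != 0 by rewrite gt_eqF.
pose s := (1 - l) / (1 - k * l).
exists a, b, (a + s *: (b - a)), k, l, s; rewrite /s.
split; split=> //.
- by rewrite k0.
- by rewrite l0.
- rewrite divr_gt0 //= ?subr_gt0 // ltr_pdivrMr // mul1r ltrD2l ltrN2.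
  by rewrite gtr_pMl.
- by rewrite zE yE; apply/rowP => i; rewrite !mxE; field.
- rewrite (funk_contract oO cO Ox ba _ yE) ?k0 ?ltW //.
  rewrite (funk_contract oO cO Oy bb _ zE) ?l0 ?ltW //.
  by rewrite lnM ?posrE // opprD.
Qed.

Lemma funk_triangle O x y z : open O -> convex_set O -> bounded_set O ->
  O x -> O y -> O z -> funk O x z <= funk O x y + funk O y z.
Proof.
move=> oO cO bO Ox Oy Oz.
have [<-|xy] := eqVneq x y; first by rewrite funk_xx add0r.
have [<-|yz] := eqVneq y z; first by rewrite funk_xx addr0.
have [a [b [w [k [l [s]]]]]] := exit_compose oO cO bO Ox Oy Oz xy yz.
move=> [[ba bb /andP[k0 k1] /andP[l0 l1] /andP[s0 s1]] [wE yE zE zwE ->]].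
apply: (funk_le_closure oO cO bO Ox _ _ zwE).1.
  move: ba bb; rewrite wE !boundaryE // => -[cla _] [clb _].
  by apply: closure_convex; rewrite ?(ltW s0) ?(ltW s1).
by rewrite mulr_gt0 // mulr_ile1 // ltW.
Qed.

(** In a strictly convex domain, equality in the triangle inequality only occurs
    for points in order on a segment. *)
Lemma strictly_convex_between O x y z :
  open O -> convex_set O -> bounded_set O -> strictly_convex O ->
  O x -> O y -> O z -> x != z -> funk O x y + funk O y z <= funk O x z ->
  exists2 t : R, 0 <= t <= 1 & y = x + t *: (z - x).
Proof.
move=> oO cO bO sO Ox Oy Oz xz.
have [<-|xy] := eqVneq x y.
  by exists 0; rewrite ?lexx ?ler01 // scale0r addr0.
have [<-|yz] := eqVneq y z.
  by exists 1; rewrite ?lexx ?ler01 // scale1r addrC subrK.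
have [a [b [w [k [l [s]]]]]] := exit_compose oO cO bO Ox Oy Oz xy yz.
move=> [[ba bb /andP[k0 k1] /andP[l0 l1] /andP[s0 s1]] [wE yE zE zwE -> le_xz]].
have kl1 : k * l < 1 by apply: (lt_trans _ l1); rewrite gtr_pMl.
have clw : closure O w.
  move: (ba) (bb); rewrite wE !boundaryE // => -[cla _] [clb _].
  by apply: closure_convex; rewrite ?(ltW s0) ?(ltW s1).
have kl01 : 0 < k * l <= 1 by rewrite mulr_gt0 // ltW.
have [le_kl bw] := funk_le_closure oO cO bO Ox clw kl01 zwE.
have /bw {}bw := xz.
have ab : a = b.
  apply/eqP; apply/negP => /negP ab; apply: sO; exists a, b; split=> //.
  apply: (segment_boundary oO cO ba bb (_ : 0 < s < 1) wE); rewrite ?s0 //.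
  by apply: bw; apply/eqP; rewrite eq_le le_kl.
have n0 : 1 - k * l != 0 by rewrite gt_eqF // subr_gt0.
exists ((1 - k) / (1 - k * l)).
  rewrite divr_ge0 ?subr_ge0 ?(ltW k1) ?(ltW kl1) //=.
  rewrite ler_pdivrMr ?subr_gt0 // mul1r.
  by rewrite lerD2l lerN2 ger_pMr // ltW.
by rewrite zE -ab yE; apply/rowP => i; rewrite !mxE; field.
Qed.

(** * Geodesics *)

(** Along such a path every partition sum telescopes to G b - G a. *)
Lemma additive_geodesic O (a b : R) (gamma : R -> V) (G : R -> R) :
  is_path O a b gamma ->
  (forall s t, a <= s -> s <= t -> t <= b ->
    funk O (gamma s) (gamma t) = G t - G s) ->
  geodesic O a b gamma.
Proof.
move=> pg FG; split=> //; have [ab _ _] := pg.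
have sumE s : itv_partition a b s ->
    \sum_(0 <= i < size s) funk O (gamma (nth b (a :: s) i))
      (gamma (nth b (a :: s) i.+1)) = G b - G a.
  move=> ps; have [sorted_s _] := ps.
  rewrite (telescope_sumr_eq (fun i => G (nth b (a :: s) i))) //.
    by rewrite (itv_partition_nth_size _ ps).
  move=> i /= si; apply: FG.
  - by apply: itv_partition_nth_ge ps; exact: ltnW.
  - by rewrite ltW //; exact: (pathP b sorted_s).
  - exact: (itv_partition_nth_le (m := i.+1) _ ps).
rewrite (FG a b) ?lexx ?(ltW ab) //.
apply/eqP; rewrite eq_le; apply/andP; split.
  apply: ereal_sup_ubound; exists [:: b]; first exact: itv_partition1.
  by rewrite (sumE [:: b]) //; exact: itv_partition1.
by apply: ge_ereal_sup => _ [s ps <-]; rewrite sumE.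
Qed.

Lemma geodesic_sum_le O (a b : R) (gamma : R -> V) s :
  geodesic O a b gamma -> itv_partition a b s ->
  \sum_(0 <= i < size s) funk O (gamma (nth b (a :: s) i))
    (gamma (nth b (a :: s) i.+1)) <= funk O (gamma a) (gamma b).
Proof.
move=> [_ lenE] ps; rewrite -lee_fin lenE.
by apply: ereal_sup_ubound; exists s.
Qed.

Lemma geodesic_between O (a b : R) (gamma : R -> V) (t : R) :
  geodesic O a b gamma -> a <= t <= b ->
  funk O (gamma a) (gamma t) + funk O (gamma t) (gamma b)
    <= funk O (gamma a) (gamma b).
Proof.
move=> gg /andP[].
rewrite le_eqVlt => /predU1P[<- _|a_t]; first by rewrite funk_xx add0r.
rewrite le_eqVlt => /predU1P[->|tb]; first by rewrite funk_xx addr0.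
have := geodesic_sum_le gg (_ : itv_partition a b [:: t; b]).
by rewrite /itv_partition /= a_t tb eqxx big_nat_recl // big_nat1; apply.
Qed.

Lemma geodesic_between2 O (a b : R) (gamma : R -> V) (s t : R) :
  geodesic O a b gamma -> a <= s -> s <= t -> t <= b ->
  funk O (gamma a) (gamma s) + (funk O (gamma s) (gamma t) +
    funk O (gamma t) (gamma b)) <= funk O (gamma a) (gamma b).
Proof.
move=> gg a_s s_t t_b.
have a_t := le_trans a_s s_t; have s_b := le_trans s_t t_b.
have [<-|a_neq_s] := eqVneq a s.
  by rewrite funk_xx add0r geodesic_between // a_t.
have [->|s_neq_t] := eqVneq s t.
  by rewrite funk_xx add0r geodesic_between // a_t.
have [->|t_neq_b] := eqVneq t b.
  have := geodesic_between gg (_ : a <= s <= b); rewrite a_s s_b => /(_ isT).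
  have := funk_xx O (gamma b).
  move: (funk _ _ _) (funk _ _ _) (funk _ _ _) => u v w ->.
  by rewrite addr0.
have := geodesic_sum_le gg (_ : itv_partition a b [:: s; t; b]).
rewrite /itv_partition /= !lt_neqAle a_neq_s a_s s_neq_t s_t t_neq_b t_b eqxx.
by rewrite 2?big_nat_recl // big_nat1; apply.
Qed.

(** On the segment from x to y all exit points coincide, and
    G t = - ln (1 - t (1 - k)) where y = a + k (x - a). *)
Lemma segment_additive O x y : open O -> convex_set O -> bounded_set O ->
  O x -> O y -> exists G : R -> R, forall s t, 0 <= s -> s <= t -> t <= 1 ->
    funk O (x + s *: (y - x)) (x + t *: (y - x)) = G t - G s.
Proof.
move=> oO cO bO Ox Oy; have [->|xy] := eqVneq x y.
  by exists (fun=> 0) => s t _ _ _; rewrite subrr !scaler0 funk_xx subrr.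
have [a [k [ba /andP[k0 k1] yE]]] := exit_exists oO bO Ox Oy xy.
exists (fun t => - ln (1 - t * (1 - k))) => s t s0 st t1.
have kt : 0 < 1 - t * (1 - k) by nra.
rewrite (funkE (p := 1 - s * (1 - k)) (q := 1 - t * (1 - k)) oO cO _ ba) //.
- by rewrite opprK addrC.
- by apply: convex_segment; rewrite ?s0 ?(le_trans st).
- by rewrite kt /=; nra.
- by rewrite yE; apply/rowP => i; rewrite !mxE; ring.
Qed.

Lemma segment_geodesic O x y : open O -> convex_set O -> bounded_set O ->
  O x -> O y -> geodesic_joining O x y 0 1 (fun t => x + t *: (y - x)).
Proof.
move=> oO cO bO Ox Oy; split; last 2 first.
- by rewrite scale0r addr0.
- by rewrite scale1r addrC subrK.
have [G FG] := segment_additive oO cO bO Ox Oy.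
apply: (additive_geodesic _ FG); split; first exact: ltr01.
  by apply: continuous_subspaceT; exact: line_continuous.
by move=> _ [t t01 <-]; exact: convex_segment.
Qed.

Lemma affine_continuous (p q : R) : continuous (fun u : R => (u - p) / q).
Proof.
move=> u; apply: cvgM; last exact: cst_continuous.
by apply: cvgB; [exact: cvg_id | exact: cst_continuous].
Qed.

(** * Uniqueness of geodesics *)

Lemma strictly_convex_uniquely_geodesic O :
  open O -> convex_set O -> bounded_set O -> strictly_convex O ->
  uniquely_geodesic O.
Proof.
move=> oO cO bO sO x y Ox Oy.
exists 0, 1, (fun t => x + t *: (y - x)); split; first exact: segment_geodesic.
move=> c d delta [gd dc dd]; have [[cd cont_d sub_d] _] := gd.
have Od t : c <= t <= d -> O (delta t).
  by move=> ctd; apply: sub_d; exists t; rewrite //= in_itv.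
have [xy|xy] := eqVneq x y.
  (* The geodesic is constant, so any change of parameter will do. *)
  exists (fun t => (t - c) / (d - c)); split.
  - by apply: continuous_subspaceT; exact: affine_continuous.
  - move=> s t _ _ st; rewrite ler_pM2r ?invr_gt0 ?subr_gt0 //.
    exact: lerB.
  - by rewrite subrr mul0r.
  - by rewrite divff // subr_eq0 gt_eqF.
  move=> t; rewrite in_itv => /= ctd; rewrite -xy subrr scaler0 addr0.
  apply/eqP; apply/negP => /negP dtx.
  have := geodesic_between gd ctd; rewrite dc dd -xy funk_xx.
  by rewrite leNgt ltr_wpDr ?funk_ge0 ?funk_gt0 // 1?eq_sym //; exact: Od.
have [j xyj] : exists j, x ord0 j != y ord0 j.
  apply/existsP; apply: contraNT xy; rewrite negb_exists => /forallP xyj.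
  by apply/eqP/rowP => j; have := xyj j; rewrite negbK => /eqP.
have xyj0 : y ord0 j - x ord0 j != 0 by rewrite subr_eq0 eq_sym.
(* The change of parameter is the position on the segment, read off a coordinate
   in which x and y differ. *)
pose phi t := (delta t ord0 j - x ord0 j) / (y ord0 j - x ord0 j).
have phiP t : c <= t <= d -> 0 <= phi t <= 1 /\ delta t = x + phi t *: (y - x).
  move=> ctd; have := geodesic_between gd ctd; rewrite dc dd.
  move=> /(strictly_convex_between oO cO bO sO Ox (Od t ctd) Oy xy)[u u01 dtE].
  suff -> : phi t = u by [].
  by rewrite /phi dtE !mxE; field.
have [G FG] := segment_additive oO cO bO Ox Oy.
exists phi; split.
- pose g (v : V) := (v ord0 j - x ord0 j) / (y ord0 j - x ord0 j).
  apply: (@within_continuous_comp _ _ _ _ delta g) => // v _.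
  apply: (@continuous_comp _ _ _ (fun v : V => v ord0 j)
    (fun u => (u - x ord0 j) / (y ord0 j - x ord0 j))).
    exact: coord_continuous.
  exact: affine_continuous.
- move=> s t; rewrite !in_itv /= => csd ctd st.
  have /andP[cs sd] := csd; have /andP[ct td] := ctd.
  have [/andP[s0 s1] dsE] := phiP s csd; have [/andP[t0 t1] dtE] := phiP t ctd.
  rewrite leNgt; apply/negP => ts.
  have Oc : O (delta c) by apply: Od; rewrite lexx ltW.
  have Odd : O (delta d) by apply: Od; rewrite lexx ltW.
  have le_st : funk O (delta c) (delta s) + funk O (delta s) (delta t)
      <= funk O (delta c) (delta t).
    rewrite -(lerD2r (funk O (delta t) (delta d))) -addrA.
    apply: le_trans (geodesic_between2 gd cs st td) _.
    exact: (funk_triangle oO cO bO Oc (Od t ctd) Odd).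
  have Fs : funk O (delta c) (delta s) = G (phi s) - G 0.
    by have := FG _ _ (lexx 0) s0 s1; rewrite scale0r addr0 -dsE dc.
  have Ft : funk O (delta c) (delta t) = G (phi t) - G 0.
    by have := FG _ _ (lexx 0) t0 t1; rewrite scale0r addr0 -dtE dc.
  have Fts : funk O (delta t) (delta s) = G (phi s) - G (phi t).
    by have := FG _ _ t0 (ltW ts) s1; rewrite -dsE -dtE.
  have : 0 < funk O (delta t) (delta s).
    apply: funk_gt0 => //; [exact: Od | exact: Od |].
    apply: contra_ltN ts => /eqP dts.
    by rewrite /phi dts.
  rewrite Fts subr_gt0; apply/negP; rewrite -leNgt.
  rewrite -(lerD2r (- G 0)) -Fs -Ft; apply: le_trans le_st.
  by rewrite lerDl funk_ge0 //; exact: Od.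
- by rewrite /phi dc subrr mul0r.
- by rewrite /phi dd divff.
- by move=> t; rewrite in_itv => /= /phiP[].
Qed.

(** The segment and gamma are both reparametrizations of one geodesic gamma0; by
    the intermediate value theorem the segment covers the whole of gamma0. *)
Lemma unique_geodesic_in_segment O x y (a b : R) (gamma : R -> V) (t : R) :
  open O -> convex_set O -> bounded_set O -> uniquely_geodesic O ->
  O x -> O y -> geodesic_joining O x y a b gamma -> a <= t <= b ->
  exists2 u : R, 0 <= u <= 1 & gamma t = x + u *: (y - x).
Proof.
move=> oO cO bO uO Ox Oy gg atb.
have [a0 [b0 [gamma0 [_ reparam]]]] := uO x y Ox Oy.
have [phi [phi_cont _ phi0 phi1 phiE]] :=
  reparam _ _ _ (segment_geodesic oO cO bO Ox Oy).
have [psi [_ psi_mono psia psib psiE]] := reparam _ _ _ gg.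
have /andP[a_t tb] := atb; have ab : a <= b by exact: le_trans tb.
have ge_psi : a0 <= psi t.
  by rewrite -psia; apply: psi_mono; rewrite ?in_itv /= ?lexx.
have le_psi : psi t <= b0.
  by rewrite -psib; apply: psi_mono; rewrite ?in_itv /= ?lexx ?ab.
have [||u u01 phiu] := IVT (v := psi t) _ phi_cont; first exact: ler01.
  by rewrite phi0 phi1 ge_min ge_psi le_max le_psi orbT.
exists u; first by move: u01; rewrite in_itv.
by rewrite psiE ?in_itv // -phiu -phiE.
Qed.

Lemma uniquely_geodesic_convexity O A :
  open O -> convex_set O -> bounded_set O -> uniquely_geodesic O ->
  A `<=` O -> geodesically_convex O A <-> convex_set A.
Proof.
move=> oO cO bO uO AO; split=> [gA|cA].
  apply: segment_convex => x y t Ax Ay t01.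
  apply: (gA x y Ax Ay _ _ _ (segment_geodesic oO cO bO (AO x Ax) (AO y Ay))).
  by exists t; rewrite //= in_itv.
move=> x y Ax Ay a b gamma gg _ [t atb <-].
have atb' : a <= t <= b by move: atb; rewrite /= in_itv.
have [u u01 ->] :=
  unique_geodesic_in_segment oO cO bO uO (AO x Ax) (AO y Ay) gg atb'.
exact: convex_segment.
Qed.

(** * Forward balls *)

(** The forward ball of centre x and radius - ln (1 - r) is the image of O under
    the homothety of centre x and ratio r. *)
Lemma forward_ball_homothety O x y (r : R) :
  open O -> convex_set O -> bounded_set O -> O x -> 0 < r < 1 ->
  forward_ball O x (- ln (1 - r)) y <-> O (x + r^-1 *: (y - x)).
Proof.
move=> oO cO bO Ox /andP[r0 r1]; have rn0 : r != 0 by rewrite gt_eqF.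
set z := x + _.
have yz : y = x + r *: (z - x).
  by rewrite /z; apply/rowP => i; rewrite !mxE; field.
have [xy|xy] := eqVneq x y.
  rewrite /z -xy subrr scaler0 addr0 /forward_ball /= funk_xx.
  by split=> // _; rewrite oppr_gt0 ln_lt0 // subr_gt0 r1 gtrBl.
split=> [[Oy]|Oz].
  have [a [k [ba /andP[k0 k1] yE]]] := exit_exists oO bO Ox Oy xy.
  rewrite (funk_contract oO cO Ox ba _ yE) ?k0 ?(ltW k1) //.
  rewrite ltrN2 ltr_ln ?posrE ?subr_gt0 // => kr.
  have := interior_segment (k := 1 - (1 - k) / r) oO cO Ox (proj1 ba).
  rewrite subr_gt0 ltr_pdivrMr // mul1r gerBl.
  rewrite divr_ge0 ?subr_ge0 ?(ltW k1) ?(ltW r0) //.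
  have -> : 1 - k < r by lra.
  move=> /(_ isT); congr O; rewrite /z yE.
  by apply/rowP => i; rewrite !mxE; field.
have Oy : O y by rewrite yz; apply: convex_segment => //; rewrite !ltW.
split=> //.
have [a [k [ba /andP[k0 k1] yE]]] := exit_exists oO bO Ox Oy xy.
rewrite (funk_contract oO cO Ox ba _ yE) ?k0 ?(ltW k1) //.
rewrite ltrN2 ltr_ln ?posrE ?subr_gt0 // ltNge; apply/negP => kr.
have k1' : 0 < 1 - k by rewrite subr_gt0.
have aE : a = x + (r / (1 - k)) *: (z - x).
  by rewrite /z yE; apply/rowP => i; rewrite !mxE; field; rewrite rn0 gt_eqF.
move: ba; rewrite boundaryE // => -[_]; apply; rewrite aE.
apply: convex_segment => //.
rewrite (ltW (divr_gt0 r0 k1')) ler_pdivrMr // mul1r.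
by lra.
Qed.

Lemma forward_ball_convex O x (rho : R) :
  open O -> convex_set O -> bounded_set O -> O x -> 0 < rho ->
  convex_set (forward_ball O x rho).
Proof.
move=> oO cO bO Ox rho0; pose r := 1 - expR (- rho).
have r01 : 0 < r < 1.
  by rewrite subr_gt0 -expR0 ltr_expR oppr_lt0 rho0 expR0 gtrBl expR_gt0.
have rhoE : rho = - ln (1 - r) by rewrite /r opprB addrC subrK expRK opprK.
rewrite rhoE; apply: segment_convex => y z t.
move=> /(forward_ball_homothety _ oO cO bO Ox r01) Oy.
move=> /(forward_ball_homothety _ oO cO bO Ox r01) Oz t01.
apply/(forward_ball_homothety _ oO cO bO Ox r01).
have := convex_segment cO Oy Oz t01; congr O.
by apply/rowP => i; rewrite !mxE; ring.
Qed.

(** * A boundary segment spoils some forward ball *)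

(** Let c be in O, m the midpoint of [p, q], u = (q - p) / 2 and w = m - c.  The
    geodesic is the broken line P s = m - (k s) w + lam (h - |s - h|) u for s in
    [0, 2 h], where k s = tau (2 - tau) - s and h = tau / 4, with lam large and
    tau = 1 / (2 lam); the ball has centre m - tau w and radius
    - ln (1 - tau). *)
Lemma flat_face_ball O p q : open O -> convex_set O -> bounded_set O ->
  O !=set0 -> p != q -> segment p q `<=` boundary O ->
  exists x (rho : R), [/\ O x, 0 < rho &
    ~ geodesically_convex O (forward_ball O x rho)].
Proof.
move=> oO cO bO [c Oc] pq face.
pose u : V := 2^-1 *: (q - p); pose m : V := p + u; pose w : V := m - c.
have faceP (e : R) : `|e| <= 1 -> boundary O (m + e *: u).
  rewrite ler_norml => /andP[e0 e1]; apply: face; apply/segmentP.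
  exists ((1 + e) / 2); first by apply/andP; split; lra.
  by apply/rowP => i; rewrite /m /u !mxE; field.
have clm : closure O m.
  by have := faceP 0; rewrite normr0 scale0r addr0 => /(_ ler01)[].
have u0 : 4^-1 *: u != 0.
  rewrite /u !scaler_eq0 subr_eq0 [q == p]eq_sym (negbTE pq).
  by rewrite !invr_eq0 !pnatr_eq0.
have [B OB] := bounded_line (c + 4^-1 *: w) bO u0.
(* lam is so large that c + (w + lam u) / 4 is outside O. *)
pose lam := Num.max B 0 + 1.
have lam1 : 1 <= lam by rewrite /lam lerDr le_max lexx orbT.
have Olam : ~ O (c + 4^-1 *: w + lam *: (4^-1 *: u)).
  by move=> /OB; apply/negP; rewrite -ltNge /lam ltr_pwDr // le_max lexx.
pose tau := (2 * lam)^-1.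
have tau0 : 0 < tau by rewrite invr_gt0 mulr_gt0 // (lt_le_trans ltr01).
have lamtau : lam * tau = 2^-1.
  by rewrite /tau; field; rewrite gt_eqF // (lt_le_trans ltr01).
have tau2 : tau <= 2^-1 by rewrite -lamtau ler_peMl // ltW.
pose h := tau / 4; have h0 : 0 < h by rewrite divr_gt0.
pose k s := tau * (2 - tau) - s.
pose beta s := h - `|s - h|.
pose P s : V := m - k s *: w + (lam * beta s) *: u.
have kpos s : s <= 2 * h -> 0 < k s by rewrite /k /h; nra.
have beta_bound s : 0 <= s <= 2 * h -> 0 <= beta s <= s.
  move=> /andP[s0 s2]; rewrite /beta subr_ge0 ler_norml lerBlDl -lerBlDr.
  by have := ler_norm (h - s); rewrite distrC => ?; apply/andP; split; lra.
have beta_lip s t : s <= t -> `|beta t - beta s| <= t - s.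
  move=> st; rewrite /beta opprB addrC addrA subrK distrC.
  have := ler_dist_dist (t - h) (s - h).
  rewrite [t - h - _](_ : _ = t - s); last by ring.
  by rewrite [`|t - s|]ger0_norm ?subr_ge0.
(* The chord from P s to P t exits at m + e u, and |e| <= lam (k s + s) <= 1
   because h - |s - h| is 1-Lipschitz and at most s; tau was chosen for this. *)
have exitP s t : 0 <= s -> s < t -> t <= 2 * h ->
    exists2 a, boundary O a & k s *: (P t - a) = k t *: (P s - a).
  move=> s0 st t2; have D0 : 0 < t - s by rewrite subr_gt0.
  pose e := lam * (k s * beta t - k t * beta s) / (t - s).
  exists (m + e *: u).
    apply: faceP; rewrite /e normrM normfV (gtr0_norm D0) ler_pdivrMr // mul1r.
    have s2 : s <= 2 * h by apply: le_trans t2; exact: ltW.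
    have /andP[bs0 bs1] := beta_bound s (introT andP (conj s0 s2)).
    have ks0 := kpos s s2.
    have := beta_lip s t (ltW st); rewrite !ler_norml => /andP[d1 d2].
    have ktE : k t = k s - (t - s) by rewrite /k; ring.
    have lam0 : 0 <= lam by exact: le_trans lam1.
    have H1 := ler_wpM2l (mulr_ge0 lam0 (ltW ks0)) d1.
    have H2 := ler_wpM2l (mulr_ge0 lam0 (ltW ks0)) d2.
    have H3 := ler_wpM2l (mulr_ge0 lam0 (ltW D0)) bs0.
    have H4 := ler_wpM2l (mulr_ge0 lam0 (ltW D0)) bs1.
    have H5 : lam * (k s + s) * (t - s) <= t - s.
      rewrite ger_pMl // /k subrK mulrA lamtau; lra.
    by rewrite ktE; apply/andP; split; lra.
  apply/rowP => i; rewrite /P /e !mxE.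
  have ktE : k t = k s - (t - s) by rewrite /k; ring.
  by rewrite ktE; field; rewrite gt_eqF.
have P0E : P 0 = m + k 0 *: (c - m).
  rewrite /P /beta sub0r normrN gtr0_norm // subrr mulr0 scale0r addr0 /w.
  by rewrite -scalerN opprB.
have O0 : O (P 0).
  rewrite P0E; apply: interior_segment => //.
  by rewrite kpos ?mulr_ge0 ?ltW //= /k; nra.
have OP s : 0 <= s <= 2 * h -> O (P s).
  move=> /andP[]; rewrite le_eqVlt => /predU1P[<- //|s0 s2].
  have [a [cla _] E] := exitP 0 s (lexx _) s0 s2.
  have k00 : 0 < k 0 by rewrite kpos // mulr_ge0 // ltW.
  have -> : P s = a + (k s / k 0) *: (P 0 - a).
    have -> : (k s / k 0) *: (P 0 - a) = (k 0)^-1 *: (k s *: (P 0 - a)).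
      by rewrite scalerA mulrC.
    by rewrite -E scalerA mulVf ?gt_eqF // scale1r addrC subrK.
  apply: interior_segment => //.
  rewrite divr_gt0 ?k00 ?(kpos _ s2) //=.
  by rewrite ler_pdivrMr // mul1r lerD2l lerN2 ltW.
have FP s t : 0 <= s -> s <= t -> t <= 2 * h ->
    funk O (P s) (P t) = - ln (k t) - - ln (k s).
  move=> s0; rewrite le_eqVlt => /predU1P[<- _|st t2].
    by rewrite funk_xx subrr.
  have [a ba E] := exitP s t s0 st t2.
  have s2 : s <= 2 * h by apply: le_trans t2; exact: ltW.
  rewrite (funkE oO cO (OP s (introT andP (conj s0 s2))) ba _ E).
    by rewrite opprK addrC.
  by rewrite kpos //= lerD2l lerN2 ltW.
have Pc : continuous P.
  move=> s; apply: (@cvgD _ _ _ (nbhs s)).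
    apply: (@cvgB _ _ _ (nbhs s)); first exact: cst_continuous.
    apply: (@cvgZ _ _ _ (nbhs s)); last exact: cst_continuous.
    by apply: cvgB; [exact: cst_continuous | exact: cvg_id].
  apply: (@cvgZ _ _ _ (nbhs s)); last exact: cst_continuous.
  apply: cvgM; first exact: cst_continuous.
  apply: cvgB; first exact: cst_continuous.
  apply: cvg_norm.
  by apply: cvgB; [exact: cvg_id | exact: cst_continuous].
have h20 : 0 < 2 * h by rewrite mulr_gt0.
have geoP : geodesic_joining O (P 0) (P (2 * h)) 0 (2 * h) P.
  split=> //; apply: (additive_geodesic _ FP); split=> //.
    exact: continuous_subspaceT.
  by move=> _ [s s02 <-]; apply: OP; move: s02; rewrite /= in_itv.
have tau1 : tau <= 1 by lra.
have Ox : O (m + tau *: (c - m)) by apply: interior_segment; rewrite ?tau0.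
have tau01 : 0 < tau < 1 by rewrite tau0; lra.
exists (m + tau *: (c - m)), (- ln (1 - tau)); split=> //.
  by rewrite oppr_gt0 ln_lt0 // subr_gt0 gtrBl tau0 andbT; lra.
have ballP y := forward_ball_homothety y oO cO bO Ox tau01.
have tn0 : tau != 0 by rewrite gt_eqF.
set ball := forward_ball _ _ _ => convex_ball.
have ball0 : ball (P 0).
  apply/ballP; move: Oc; congr O.
  by rewrite P0E; apply/rowP => i; rewrite /k !mxE; field.
have ball2h : ball (P (2 * h)).
  apply/ballP; have := interior_segment (k := 2^-1) oO cO Oc clm.
  rewrite invr_gt0 ltr0n invf_le1 // ler1n => /(_ isT); congr O.
  have b0 : beta (2 * h) = 0.
    by rewrite /beta (_ : 2 * h - h = h) ?gtr0_norm ?subrr //; ring.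
  by apply/rowP => i; rewrite /P b0 /k /h /w !mxE; field.
(* The vertex P h is the image of c + (w + lam u) / 4 under the homothety. *)
have /ballP : ball (P h).
  apply: (convex_ball _ _ ball0 ball2h _ _ _ geoP).
  by exists h => //=; rewrite in_itv /= ltW //=; lra.
move=> Oh; apply: Olam; move: Oh; congr O.
have bh : beta h = tau / 4 by rewrite /beta subrr normr0 subr0.
by apply/rowP => i; rewrite /P bh /k /h /w !mxE; field.
Qed.

End FunkTheory.

Theorem corollary7p8 (R : realType) (n : nat) (Omega : set 'rV[R]_n)
    (Omega_convex : convex_domain Omega) (Omega_bounded : bounded_set Omega) :
  [<-> strictly_convex Omega;
       uniquely_geodesic Omega;
       forall A : set 'rV[R]_n, A `<=` Omega ->
         (geodesically_convex Omega A <-> convex_set A);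
       forall (x : 'rV[R]_n) (rho : R), Omega x -> 0 < rho ->
         geodesically_convex Omega (forward_ball Omega x rho)].
Proof.
have [ne oO cO] := Omega_convex; have bO := Omega_bounded.
tfae.
- exact: strictly_convex_uniquely_geodesic.
- by move=> uO A AO; exact: uniquely_geodesic_convexity.
- move=> equiv x rho Ox rho0.
  by apply/equiv; [move=> y [] | exact: forward_ball_convex].
- move=> balls [p [q [pq face]]].
  have [x [rho [Ox rho0]]] := flat_face_ball oO cO bO ne pq face.
  by apply; exact: balls.
Qed.
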